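(* Let $G$ be an undirected graph, let $T$ be a DFS tree of $G$ rooted at the super root $r$, and let $U$ be a set of vertex and edge insertions. Then the algorithm BatchInsert described below, run on $T$ and $U$, correctly outputs (via the parent pointers $\mathit{par}^*$) a DFS tree $T^*$ of $G+U$.
   Context: $G+U$ is the graph obtained from $G$ by applying the insertions in $U$. A DFS tree of an undirected graph is a rooted spanning tree in which every non-tree edge joins an ancestor and a descendant. The root $r$ is a super root, adjacent to every vertex (including inserted vertices). Notation for the tree $T$: $T(x)$ is the subtree rooted at $x$; $\mathit{par}(x)$ is the parent of $x$; $\mathit{path}(x,y)$ is the tree path from $x$ to $y$. For a subtree $T(w)$ and a vertical path $\mathit{path}(u,v)$ ($u$ an ancestor of $v$), the query $Q(T(w),u,v)$ returns an edge $(y,z)$ of $G$ with $y\in\mathit{path}(u,v)$ and $z\in T(w)$ such that $y$ is the highest (closest to the root) vertex of $\mathit{path}(u,v)$ adjacent in $G$ to some vertex of $T(w)$; it returns Null if no edge of $G$ joins $\mathit{path}(u,v)$ and $T(w)$. Algorithm BatchInsert$(T,U)$: (1) add each inserted vertex $v$ to $T$ with $\mathit{par}(v)=r$; (2) set $L(v)=\emptyset$ for each vertex $v$; (3) for each inserted edge $(a,b)$ add $b$ to $L(a)$ and $a$ to $L(b)$; (4) all vertices are initially unvisited; call DFS$(r)$. Procedure DFS$(v)$: let $u=v$; while $\mathit{par}(u)$ exists and is unvisited, set $u=\mathit{par}(u)$. Mark all vertices of $\mathit{path}(u,v)=(w_1=u,w_2,\dots,w_t=v)$ visited. For each $i\in[t]$: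 if $i\neq t$ set $\mathit{par}^*(w_i)=w_{i+1}$; for each child $x$ of $w_i$ in $T$ other than $w_{i+1}$, compute $(y,z)=Q(T(x),u,v)$ with $y\in\mathit{path}(u,v)$ and, if it is not Null, add $z$ to $L(y)$. Then for each $i=1,\dots,t$ in order and each $x\in L(w_i)$: if $x$ is unvisited, set $\mathit{par}^*(x)=w_i$ and call DFS$(x)$. *)

(* Defs.v *)
From mathcomp Require Import all_boot.

Set Implicit Arguments.
Unset Strict Implicit.
Unset Printing Implicit Defensive.

(** * Graphs and rooted trees *)

(* A finite graph whose vertices are taken from an ambient finite type [V],
   which also has to provide the vertices that are inserted later. *)
Record graph (V : finType) := Graph { vset : {set V}; adj : rel V }.

Definition undirected (V : finType) (G : graph V) : Prop :=
  symmetric (adj G) /\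
  (forall x y, adj G x y -> x \in vset G /\ y \in vset G).

Definition super_root (V : finType) (G : graph V) (r : V) : Prop :=
  r \in vset G /\ (forall v, v \in vset G -> v != r -> adj G r v).

(* Rooted trees are given by their parent pointers. [anc par x y]: [x] is an
   ancestor of [y], possibly [y] itself; equivalently, [y] lies in the subtree
   [T(x)]. *)
Definition anc (V : finType) (par : V -> option V) : rel V :=
  fun x y => connect (fun b a => par b == Some a) y x.

(* Membership in [path(u,v)], for [u] an ancestor of [v]. *)
Definition on_path (V : finType) (par : V -> option V) (u v : V) : pred V :=
  fun y => anc par u y && anc par y v.

Definition spanning_tree (V : finType) (G : graph V) (r : V)
    (par : V -> option V) : Prop :=
  [/\ r \in vset G,
      par r = None,
      forall v, v \in vset G -> v != r ->
        exists2 p, par v = Some p & adj G v p,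
      forall v, v \notin vset G -> par v = None
    & forall v, v \in vset G -> anc par r v].

Definition dfs_tree (V : finType) (G : graph V) (r : V)
    (par : V -> option V) : Prop :=
  spanning_tree G r par /\
  (forall x y, adj G x y -> par x != Some y -> par y != Some x ->
     anc par x y || anc par y x).

(** * Insertions *)

(* [inl v] inserts the vertex [v], [inr (a, b)] inserts the undirected edge
   between [a] and [b]; the edges that come with a new vertex are listed as
   edge insertions. *)
Notation insertion V := (V + V * V)%type (only parsing).

Definition new_vertices (V : finType) (U : {set insertion V}) : {set V} :=
  [set v | inl v \in U].

Definition new_edge (V : finType) (U : {set insertion V}) : rel V :=
  fun a b => (inr (a, b) \in U) || (inr (b, a) \in U).

Definition valid_insertions (V : finType) (G : graph V)
    (U : {set insertion V}) : Prop :=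
  (forall v, v \in new_vertices U -> v \notin vset G) /\
  (forall a b, inr (a, b) \in U ->
     a \in vset G :|: new_vertices U /\ b \in vset G :|: new_vertices U).

(* [G] with the new vertices only. As the super root is adjacent to every
   vertex, each new vertex comes with its edge to [r]. *)
Definition insert_vertices (V : finType) (G : graph V) (r : V)
    (U : {set insertion V}) : graph V :=
  Graph (vset G :|: new_vertices U)
    (fun x y => [|| adj G x y, (x == r) && (y \in new_vertices U)
                  | (y == r) && (x \in new_vertices U)]).

(* [G + U] *)
Definition insert (V : finType) (G : graph V) (r : V)
    (U : {set insertion V}) : graph V :=
  Graph (vset G :|: new_vertices U)
    (fun x y => adj (insert_vertices G r U) x y || new_edge U x y).

(** * Resources of the algorithm *)

(* [Q w u v] stands for [Q(T(w), u, v)], and [None] for Null. *)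
Definition query_spec (V : finType) (G : graph V) (par : V -> option V)
    (Q : V -> V -> V -> option (V * V)) : Prop :=
  forall w u v, w \in vset G -> u \in vset G -> v \in vset G -> anc par u v ->
  match Q w u v with
  | Some (y, z) =>
      [/\ on_path par u v y, anc par w z, adj G y z
        & forall y' z', on_path par u v y' -> anc par w z' -> adj G y' z' ->
            anc par y y']
  | None =>
      forall y z, on_path par u v y -> anc par w z -> ~~ adj G y z
  end.

(* [ord w A] is the order in which the loop over [A = L(w)] is run. That loop
   is run at most once for each [w], so that quantifying over [ord] accounts
   for all the ways to resolve the unspecified orders. *)
Definition order_spec (V : finType) (ord : V -> {set V} -> seq V) : Prop :=
  forall w A, perm_eq (ord w A) (enum A).

(** * The algorithm *)

Record state (V : finType) := State {
  visited : {set V};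
  adjl : V -> {set V};          (* the sets [L(v)] *)
  parS : V -> option V          (* the output pointers [par*] *)
}.

Definition mark (V : finType) (p : seq V) (s : state V) : state V :=
  State (visited s :|: [set x in p]) (adjl s) (parS s).

Definition add_adj (V : finType) (y z : V) (s : state V) : state V :=
  State (visited s) [eta adjl s with y |-> z |: adjl s y] (parS s).

Definition set_parS (V : finType) (x w : V) (s : state V) : state V :=
  State (visited s) (adjl s) [eta parS s with x |-> Some w].

(* Loops and recursive calls are bounded by a fuel; [None] as a result means
   that the fuel ran out. *)
Definition for_each (A S : Type) (f : A -> S -> option S) (l : seq A) (s : S)
    : option S :=
  foldl (fun os a => obind (f a) os) (Some s) l.

(* The while loop of [DFS(v)]. The result is the list [path(u,v)], from its top
   vertex [u] down to [v]; [below] is the part of it strictly below [u]. *)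
Fixpoint climb (V : finType) (par : V -> option V) (vis : {set V}) (n : nat)
    (u : V) (below : seq V) : option (seq V) :=
  if n is n'.+1 then
    match par u with
    | Some p => if p \notin vis then climb par vis n' p (u :: below)
                else Some (u :: below)
    | None => Some (u :: below)
    end
  else None.

(* The first loop of [DFS(v)], over the remaining part [p = (w_i, ..., w_t)] of
   [path(u,v)]. *)
Fixpoint scan (V : finType) (par : V -> option V)
    (Q : V -> V -> V -> option (V * V)) (u v : V) (p : seq V) (s : state V)
    : state V :=
  if p is w :: p' then
    let s1 := if p' is w' :: _ then set_parS w w' s else s in
    let s2 := foldl (fun s x => if Q x u v is Some (y, z) then add_adj y z s
                                else s)
                    s1 [seq x <- enum V | (par x == Some w)
                                          && (Some x != ohead p')] in
    scan par Q u v p' s2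
  else s.

Fixpoint dfs (V : finType) (par : V -> option V)
    (Q : V -> V -> V -> option (V * V)) (ord : V -> {set V} -> seq V)
    (n : nat) (v : V) (s : state V) : option (state V) :=
  if n is n'.+1 then
    if climb par (visited s) n' v [::] is Some p then
      for_each (fun w s =>
          for_each (fun x s =>
              if x \in visited s then Some s
              else dfs par Q ord n' x (set_parS x w s))
            (ord w (adjl s w)) s)
        p (scan par Q (head v p) v p (mark p s))
    else None
  else None.

Definition extend_tree (V : finType) (r : V) (U : {set insertion V})
    (par : V -> option V) : V -> option V :=
  fun v => if v \in new_vertices U then Some r else par v.

Definition initial_state (V : finType) (U : {set insertion V}) : state V :=
  State set0 (fun a => [set b | new_edge U a b]) (fun=> None).

Definition batch_insert (V : finType) (r : V)
    (Q : V -> V -> V -> option (V * V)) (ord : V -> {set V} -> seq V)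
    (par : V -> option V) (U : {set insertion V}) (n : nat)
    : option (V -> option V) :=
  omap (@parS V) (dfs (extend_tree r U par) Q ord n r (initial_state U)).

(* The run terminates with the parent pointers [parT]. *)
Definition batch_insert_outputs (V : finType) (r : V)
    (Q : V -> V -> V -> option (V * V)) (ord : V -> {set V} -> seq V)
    (par : V -> option V) (U : {set insertion V}) (parT : V -> option V)
    : Prop :=
  exists n0, forall n, n0 <= n -> batch_insert r Q ord par U n = Some parT.

(* Main.v *)
Require Import Defs.
From mathcomp Require Import all_boot.

(* The visited set is closed under taking parents in [T], so the unvisited
   vertices form full subtrees, which only inserted edges can join. Each call
   DFS(v) leaves no edge from a vertex it visits to an unvisited vertex, and
   all the vertices it visits become descendants of [v] in [T*]. Hence the
   calls made from one path have no edges between the parts they visit. When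
   the loop leaves a path vertex [w], no neighbor of [w] is unvisited, because
   a query returns the vertex of the path that is highest in [T], that is,
   treated first. So the part visited by a call from [w] has edges only to
   path vertices treated no earlier than [w], which are ancestors of [w] in
   [T*]. *)

(** * Ancestors and vertical paths in a forest of parent pointers *)

Section Ancestors.
Set Implicit Arguments.
Unset Strict Implicit.

Variable V : finType.
Implicit Types (par : V -> option V) (a c u v w x y : V) (p q s : seq V).

Lemma anc_refl par x : anc par x x.
Proof. exact: connect0. Qed.

Lemma anc_trans par x y z : anc par x y -> anc par y z -> anc par x z.
Proof. by move=> xy yz; apply: connect_trans yz xy. Qed.

Lemma anc_par par x a : par x = Some a -> anc par a x.
Proof. by move=> xa; apply: connect1; rewrite xa. Qed.

Lemma anc_mono par par' :
  (forall x a, par x = Some a -> par' x = Some a) ->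
  forall x y, anc par x y -> anc par' x y.
Proof.
move=> sub x y; apply: connect_sub => b a /eqP ba.
by apply: connect1; rewrite (sub _ _ ba).
Qed.

Lemma anc_ind_down par a (P : V -> Prop) :
  P a ->
  (forall x b, par x = Some b -> anc par a b -> P b -> P x) ->
  forall x, anc par a x -> P x.
Proof.
move=> Pa Pstep x /connectP[s]; elim: s x => [|b s IHs] x /=.
  by move=> _ <-.
case/andP=> /eqP xb bs ea.
by apply: (Pstep _ _ xb); [apply/connectP; exists s | apply: IHs].
Qed.

(** Mostly used to see that a vertex set closed under parents contains all the ancestors of its
    members. *)
Lemma anc_ind_up par x (P : V -> Prop) :
  P x -> (forall y b, par y = Some b -> P y -> P b) ->
  forall a, anc par a x -> P a.
Proof.
move=> Px Pstep a /connectP[s]; elim: s x Px => [|b s IHs] x Px /=.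
  by move=> _ ->.
by case/andP=> /eqP xb bs ea; apply: (IHs b) => //; apply: Pstep xb Px.
Qed.

(** The climb from [x] towards [a] stops at the first vertex [w] of [A]. With [A] the visited set,
    [c] is the root of the hanging subtree that contains [x]. *)
Lemma anc_enter par (A : {pred V}) a x :
  anc par a x -> a \in A -> x \notin A ->
  exists c w, [/\ c \notin A, w \in A, par c = Some w, anc par c x
                & anc par a w].
Proof.
move=> ax aA; move: x ax; apply: anc_ind_down; first by rewrite aA.
move=> x b xb ab IHb xA; have [bA|bA] := boolP (b \in A).
  by exists x, b; split=> //; apply: anc_refl.
have [c [w [cA wA cw cb aw]]] := IHb bA.
by exists c, w; split=> //; apply: anc_trans cb (anc_par xb).
Qed.

Lemma path_anc_down par w s x :
  path (fun a b => par b == Some a) w s -> x \in s -> anc par w x.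
Proof.
elim: s w => //= b s IHs w /andP[/eqP wb bs]; rewrite inE.
case/predU1P=> [->|xs]; first exact: anc_par.
exact: anc_trans (anc_par wb) (IHs _ bs xs).
Qed.

Lemma path_anc_up par w s x :
  path (fun a b => par a == Some b) w s -> x \in s -> anc par x w.
Proof.
elim: s w => //= b s IHs w /andP[/eqP wb bs]; rewrite inE.
case/predU1P=> [->|xs]; first exact: anc_par.
exact: anc_trans (IHs _ bs xs) (anc_par wb).
Qed.

Lemma path_pred (e : rel V) w s x :
  path e w s -> x \in s -> exists2 b, b \in w :: s & e b x.
Proof.
elim: s w => //= b s IHs w /andP[wb bs]; rewrite inE.
case/predU1P=> [->|xs]; first by exists w => //; rewrite inE eqxx.
by have [c cs cx] := IHs _ bs xs; exists c => //; rewrite inE cs orbT.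
Qed.

Lemma path_succ (e : rel V) w s x :
  path e w s -> x \in w :: s -> x = last w s \/ exists b, e x b.
Proof.
elim: s w => [|b s IHs] w /=; first by rewrite inE => _ /eqP; left.
case/andP=> wb bs; rewrite inE => /predU1P[->|]; first by right; exists b.
exact: IHs.
Qed.

(** The chain [q] of the proper ancestors of [v] shows that the while loop ends. The loop keeps a
    part [p] of it, listed upwards, and returns it reversed, hence [catrev]. *)
Lemma climb_spec par (vis : {set V}) q : forall v below,
  path (fun b a => par b == Some a) v q -> par (last v q) = None ->
  exists p, [/\ subseq p q, path (fun b a => par b == Some a) v p,
    {in p, forall x, x \notin vis},
    forall a, par (last v p) = Some a -> a \in vis
  & forall n, size p < n -> climb par vis n v below = Some (catrev p (v :: below))].
Proof.
elim: q => [|b q IHq] v below /=.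
  by move=> _ vN; exists [::]; split=> //= [a|[|n]] //=; rewrite vN.
case/andP=> /eqP vb bq bN; have [bvis|bvis] := boolP (b \in vis).
  by exists [::]; split=> //= [a|[|n]] //=; rewrite vb ?bvis // => -[<-].
have [p [pq pp pvis pa pclimb]] := IHq b (v :: below) bq bN.
exists (b :: p); split=> //=.
- by rewrite eqxx.
- by rewrite vb eqxx.
- by move=> x; rewrite inE => /predU1P[->|] //; apply: pvis.
- by case=> //= n np; rewrite vb bvis pclimb.
Qed.

(** Climbing from [x] follows the chain up to its top [u], then enters [vis] and stays there, since
    [vis] is closed under parents. *)
Lemma chain_anc par (vis : {set V}) u s a x :
  path (fun a b => par b == Some a) u s ->
  (forall b, par u = Some b -> b \in vis) ->
  (forall y b, par y = Some b -> y \in vis -> b \in vis) ->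
  x \in u :: s -> anc par a x -> (a \in u :: s) || (a \in vis).
Proof.
move=> us ub clo xs; move: a.
apply: (@anc_ind_up _ _ (fun a => (a \in u :: s) || (a \in vis))).
  by rewrite xs.
move=> y b yb /orP[|yvis]; last by rewrite (clo _ _ yb yvis) orbT.
rewrite inE => /predU1P[yu|ys]; first by rewrite ub ?orbT // -yu.
have [c cs /eqP] := path_pred us ys.
by rewrite yb => -[->]; rewrite cs.
Qed.

End Ancestors.

(** * The first loop of a call: path reversal and recorded query answers *)

Section Scan.
Set Implicit Arguments.
Unset Strict Implicit.

Variables (V : finType) (par : V -> option V).
Variables (Q : V -> V -> V -> option (V * V)) (u v : V).
Implicit Types (s t : state V) (p l : seq V).

Let record_edge s x := if Q x u v is Some (y, z) then add_adj y z s else s.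

Lemma record_edges_spec l s :
  let t := foldl record_edge s l in
  [/\ visited t = visited s, parS t = parS s,
      forall y, adjl s y \subset adjl t y,
      forall y z, z \in adjl t y ->
        z \in adjl s y \/ exists2 x, x \in l & Q x u v = Some (y, z)
    & forall x y z, x \in l -> Q x u v = Some (y, z) -> z \in adjl t y].
Proof.
elim: l s => [|x l IHl] s /=; first by split=> //; auto.
have [-> -> sub sound compl] := IHl (record_edge s x).
have sub1 y : adjl s y \subset adjl (record_edge s x) y.
  rewrite /record_edge; case: (Q x u v) => [[a b]|] //=.
  by case: eqP => // ->; apply: subsetUr.
split=> //.
- by rewrite /record_edge; case: (Q x u v) => [[a b]|].
- by rewrite /record_edge; case: (Q x u v) => [[a b]|].
- by move=> y; apply: subset_trans (sub1 y) (sub y).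
- move=> y z /sound[]; last first.
    by case=> x' x'l e; right; exists x' => //; rewrite inE x'l orbT.
  rewrite /record_edge; case e: (Q x u v) => [[a b]|] /=; last by left.
  case: eqP => [->|_]; last by left.
  rewrite !inE => /predU1P[->|]; last by left.
  by right; exists x => //; rewrite inE eqxx.
- move=> x' y z; rewrite inE => /predU1P[->|]; last exact: compl.
  move=> e; apply: (subsetP (sub y)).
  by rewrite /record_edge e /= eqxx !inE eqxx.
Qed.

(** Uniqueness of [p] ensures that a pointer set on the path is not overwritten further down. The
    last path vertex keeps the pointer it got from the caller; in [last x p] the vertex [x] is only
    a default for empty [p]. *)
Lemma scan_spec p s : uniq p ->
  let t := scan par Q u v p s in
  [/\ visited t = visited s,
      forall y, adjl s y \subset adjl t y,
      forall y z, z \in adjl t y ->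
        z \in adjl s y \/
        exists x w, [/\ par x = Some w, w \in p & Q x u v = Some (y, z)],
      forall x w y z, w \in p -> par x = Some w -> x \notin p ->
        Q x u v = Some (y, z) -> z \in adjl t y
    & [/\ forall x, x \notin p -> parS t x = parS s x,
      sorted (fun a b => parS t a == Some b) p
    & forall x, parS t (last x p) = parS s (last x p)]].
Proof.
elim: p s => [|w p IHp] s /=; first by move=> _; split=> //; left.
case/andP=> wp up.
set s1 := (if p is w' :: _ then set_parS w w' s else s).
set l := [seq x <- _ | _].
have [vis2 parS2 sub2 sound2 compl2] := record_edges_spec l s1.
set s2 := foldl _ s1 l in vis2 parS2 sub2 sound2 compl2 *.
have [-> sub sound compl [parSN parSp parSl]] := IHp s2 up.
have adj1 y : adjl s1 y = adjl s y by rewrite /s1; case: (p).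
have sub' y : adjl s y \subset adjl s2 y by rewrite -adj1.
have parSx x : x != w -> parS s2 x = parS s x.
  by rewrite parS2 /s1; case: (p) => //= b _ /negPf->.
split.
- by rewrite vis2 /s1; case: (p).
- by move=> y; apply: subset_trans (sub y).
- move=> y z /sound[/sound2[]|].
  + by rewrite adj1; left.
  + case=> x; rewrite mem_filter => /andP[/andP[/eqP xw _] _] e.
    by right; exists x, w; rewrite inE eqxx.
  + by case=> x [w' [? ? ?]]; right; exists x, w'; rewrite inE; split=> //; apply/orP; right.
- move=> x w' y z; rewrite !inE negb_or => /predU1P[->|w'p] xw /andP[xnw xp] e.
    apply: (subsetP (sub y)); apply: (compl2 x) => //.
    rewrite mem_filter xw eqxx mem_enum inE andbT /=.
    by apply: contraNneq xp; case: (p) => //= b p' [->]; rewrite inE eqxx.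
  exact: compl w'p xw xp e.
- split.
  + move=> x; rewrite inE negb_or => /andP[xw xp].
    by rewrite parSN // parSx.
  + have pw := parSN _ wp.
    move: parSp pw; rewrite parS2 /s1; case: (p) => //= b p' -> ->.
    by rewrite !eqxx.
  + move=> _; rewrite parSl; have [p0|p_neq0] := eqVneq p [::].
      by rewrite parS2 /s1 p0.
    have lp : last w p \in p by case: (p) p_neq0 => //= b p' _; apply: mem_last.
    by apply: parSx; apply: contraNneq wp => <-.
Qed.

End Scan.

(** * Invariants of the recursive search *)

Section Correctness.
Set Implicit Arguments.
Unset Strict Implicit.

(** [W] and [E] form the graph with the inserted vertices only, the one that [par] is a DFS tree of
    and that the queries see; [F] consists of the inserted edges. *)
Variables (V : finType) (W : {set V}) (E F : rel V) (r : V).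
Variables (par : V -> option V) (Q : V -> V -> V -> option (V * V)).
Variable ord : V -> {set V} -> seq V.
Implicit Types (s t : state V) (p : seq V).

Let EF x y := E x y || F x y.

Hypothesis E_sym : symmetric E.
Hypothesis F_sym : symmetric F.
Hypothesis EF_vertex : forall x y, EF x y -> y \in W.
Hypothesis par_root : par r = None.
Hypothesis par_edge : forall x a, par x = Some a -> E x a.
Hypothesis anc_root : forall x, x \in W -> anc par r x.
Hypothesis E_anc : forall x y, E x y -> anc par x y || anc par y x.
Hypothesis Q_spec : query_spec (Graph W E) par Q.
Hypothesis ord_spec : order_spec ord.

Lemma EF_sym : symmetric EF.
Proof. by move=> x y; rewrite /EF E_sym F_sym. Qed.

Lemma par_vertex x a : par x = Some a -> x \in W.
Proof. by move=> /par_edge xa; apply: (@EF_vertex a); rewrite /EF E_sym xa. Qed.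

(* The output pointers are undefined outside the visited vertices, except at
   the argument [o] of a call that is about to start. *)
Record inv (o : option V) s : Prop := Inv {
  inv_vertex : visited s \subset W;
  inv_par : forall x a, par x = Some a -> x \in visited s -> a \in visited s;
  inv_sound : forall x y, y \in adjl s x -> EF x y;
  inv_new_edge : forall x y, F x y -> y \in adjl s x;
  inv_parS : forall x a, parS s x = Some a -> EF x a;
  inv_fresh : forall x, x \notin visited s -> Some x != o -> parS s x = None }.

(** Pointers once set are kept, so ancestor relations in [T*] carry over to later states by
    [anc_mono]. *)
Record grows s t : Prop := Grows {
  grows_visited : visited s \subset visited t;
  grows_adjl : forall x, adjl s x \subset adjl t x;
  grows_parS : forall x a, parS s x = Some a -> parS t x = Some a }.

Lemma grows_refl s : grows s s.
Proof. by split. Qed.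

Lemma grows_trans s t t' : grows s t -> grows t t' -> grows s t'.
Proof.
case=> v1 a1 p1 [v2 a2 p2]; split.
- exact: subset_trans v1 v2.
- by move=> x; apply: subset_trans (a1 x) (a2 x).
- by move=> x a /p1/p2.
Qed.

(* [v] roots a DFS tree of the part of the graph visited between [s] and [t],
   a part which no edge leaves towards an unvisited vertex. *)
Record explored v s t : Prop := Explored {
  expl_root : v \in visited t;
  expl_parS : forall x, (x == v) || (x \in visited s) -> parS t x = parS s x;
  expl_closed : forall x y, x \in visited t -> x \notin visited s -> EF x y ->
    y \in visited t;
  expl_anc : forall x, x \in visited t -> x \notin visited s ->
    anc (parS t) v x;
  expl_dfs : forall x y, x \in visited t -> x \notin visited s ->
    y \in visited t -> y \notin visited s -> EF x y ->
    anc (parS t) x y || anc (parS t) y x }.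

(** * Analysis of a single call *)

Section Call.

(* A call to [DFS(v)] in the state [s]; [s1] is the state after its first
   loop and [p] is [path(u, v)]. *)
Variables (v : V) (s s1 : state V) (u : V) (q : seq V).
Let p := u :: q.

Hypothesis s_inv : inv (Some v) s.
Hypothesis p_path : path (fun a b => par b == Some a) u q.
Hypothesis p_last : last u q = v.
Hypothesis p_vertex : {in p, forall x, x \in W}.
Hypothesis p_fresh : {in p, forall x, x \notin visited s}.
Hypothesis p_uniq : uniq p.
Hypothesis u_par : forall a, par u = Some a -> a \in visited s.
Hypothesis s1_def : s1 = scan par Q u v p (mark p s).

Let V1 := visited s1.

Lemma visited_scan : V1 = visited s :|: [set x in p].
Proof. by rewrite /V1 s1_def; case: (scan_spec par Q u v (mark p s) p_uniq). Qed.

Lemma mem_V1 x : (x \in V1) = (x \in visited s) || (x \in p).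
Proof. by rewrite visited_scan !inE. Qed.

Lemma mem_on_path x : x \in p -> on_path par u v x.
Proof.
move=> xp; apply/andP; split.
  by move: xp; rewrite inE => /predU1P[->|/(path_anc_down p_path)//]; apply: anc_refl.
move: p_path xp; rewrite -p_last /p; elim: (q) (u) x => [|b q' IHq] a x /=.
  by rewrite inE => _ /eqP->; apply: anc_refl.
case/andP=> /eqP ab bq; rewrite inE => /predU1P[->|]; last exact: IHq.
exact: anc_trans (anc_par ab) (IHq _ _ bq (mem_head _ _)).
Qed.

(** A vertex between [u] and [v] but off [p] would be visited by [chain_anc], and so would its
    ancestor [u], which is fresh. *)
Lemma on_path_mem x : on_path par u v x -> x \in p.
Proof.
case/andP=> ux xv.
have vp : v \in p by rewrite -p_last; apply: mem_last.
have /orP[//|xs] := chain_anc p_path u_par (inv_par s_inv) vp xv.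
have us : u \in visited s.
  exact: (anc_ind_up (P := fun a => a \in visited s) xs (inv_par s_inv) ux).
by have := p_fresh (mem_head u q); rewrite us.
Qed.

(** No pointer is overwritten: a path vertex other than [v] has none before the scan, and [v] keeps
    its own. *)
Lemma scan_grows : grows s s1.
Proof.
have [vis sub _ _ [parN _ parl]] := scan_spec par Q u v (mark p s) p_uniq.
rewrite -s1_def in vis sub parN parl *.
split=> // [|x a xa]; first by rewrite vis subsetUl.
have [xp|/parN->//] := boolP (x \in p).
have [xv|xv] := eqVneq x v.
  by move: (parl u) => /=; rewrite p_last -xv => ->.
have xv' : Some x != Some v by apply: contraNneq xv => -[->].
by rewrite (inv_fresh s_inv (p_fresh xp) xv') in xa.
Qed.

Lemma scan_parS x : (x == v) || (x \in visited s) -> parS s1 x = parS s x.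
Proof.
have [_ _ _ _ [parN _ parl]] := scan_spec par Q u v (mark p s) p_uniq.
rewrite -s1_def in parN parl *; case/predU1P=> [->|xs].
  by rewrite /= p_last in parl; apply: (parl u).
by apply: parN; apply: contraL xs; apply: p_fresh.
Qed.

Lemma scan_path : path (fun a b => parS s1 a == Some b) u q.
Proof.
have [_ _ _ _ [_ + _]] := scan_spec par Q u v (mark p s) p_uniq.
by rewrite -s1_def.
Qed.

Lemma Q_path x : x \in W ->
  if Q x u v is Some (y, z) then
    [/\ y \in p, anc par x z, E y z
      & forall y' z', y' \in p -> anc par x z' -> E y' z' -> anc par y y']
  else forall y z, y \in p -> anc par x z -> ~~ E y z.
Proof.
move=> xW; have uW := p_vertex (mem_head u q).
have vW : v \in W by apply: p_vertex; rewrite -p_last mem_last.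
have /andP[_ uv] := mem_on_path (mem_head u q).
have := Q_spec xW uW vW uv; case: (Q x u v) => [[y z]|] /=.
  case=> yp xz yz top; split=> //; first exact: on_path_mem.
  by move=> y' z' /mem_on_path; apply: top.
by move=> none y z /mem_on_path; apply: none.
Qed.

Lemma scan_inv : inv None s1.
Proof.
have [vis sub sound _ [parN parp parl]] :=
  scan_spec par Q u v (mark p s) p_uniq.
rewrite -s1_def in vis sub sound parN parp parl *.
split.
- rewrite vis subUset (inv_vertex s_inv); apply/subsetP => x.
  by rewrite inE => /p_vertex.
- move=> x a xa; rewrite -/V1 !mem_V1 => /orP[xs|].
    by rewrite (inv_par s_inv xa xs).
  rewrite inE => /predU1P[xu|/(path_pred p_path)[b bp]].
    by rewrite u_par // -xu.
  by rewrite xa => /eqP[->]; rewrite bp orbT.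
- move=> x y /sound[/(inv_sound s_inv)//|[c [w [cw _ e]]]].
  have := Q_path (par_vertex cw); rewrite e => -[_ _ xy _].
  by rewrite /EF xy.
- by move=> x y xy; apply: (subsetP (sub x)); apply: (inv_new_edge s_inv).
- move=> x a xa; have [xp|xp] := boolP (x \in p); last first.
    by move: xa; rewrite parN // => /(inv_parS s_inv).
  (* The path is read in [T] and in [T*] at once: the new pointer of a path vertex goes to its child
     [b] in [T], hence along an edge. *)
  have pp : path [rel a b | (par b == Some a) && (parS s1 a == Some b)] u q.
    by rewrite path_relI p_path scan_path.
  case: (path_succ pp xp) => [xv|[b /andP[/eqP bx /eqP xb]]].
    by move: xa; rewrite xv p_last scan_parS ?eqxx // => /(inv_parS s_inv).
  move: xa; rewrite xb => -[<-].
  by rewrite EF_sym /EF (par_edge bx).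
- move=> x; rewrite -/V1 mem_V1 negb_or => /andP[xs xp] _.
  rewrite parN //; apply: (inv_fresh s_inv) => //.
  by apply: contraNneq xp => -[->]; rewrite -p_last mem_last.
Qed.

(* The state [t] of the second loop once the vertices of [p1], a prefix of
   [path(u, v)], have been dealt with. *)
Record loop_inv (p1 : seq V) t : Prop := LoopInv {
  loop_state : inv None t;
  loop_grows : grows s1 t;
  loop_parS : forall x, (x == v) || (x \in visited s) -> parS t x = parS s1 x;
  loop_closed : forall x y, x \in visited t -> x \notin V1 -> EF x y ->
    y \in visited t;
  loop_anc : forall x, x \in visited t -> x \notin visited s ->
    anc (parS t) v x;
  loop_dfs : forall x y, x \in visited t -> x \notin visited s ->
    y \in visited t -> y \notin visited s -> EF x y ->
    anc (parS t) x y || anc (parS t) y x;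
  loop_adjl : forall w x, w \in p1 -> x \in adjl s1 w -> x \in visited t;
  loop_done : forall w x, w \in p1 -> EF w x -> x \in visited t }.

(** The scan turns the path upside down: each pointer goes to the next path vertex, so those treated
    later are ancestors in [T*] of those treated earlier. *)
Lemma path_scan_anc p1 w p2 w' :
  p = p1 ++ w :: p2 -> w' \in w :: p2 -> anc (parS s1) w' w.
Proof.
move=> def_p; rewrite inE => /predU1P[->|w'p]; first exact: anc_refl.
suff: path (fun a b => parS s1 a == Some b) w p2 by move/path_anc_up; apply.
case: p1 def_p => [|a p1] [eu eq]; have := scan_path; rewrite eq; first by rewrite eu.
by rewrite cat_path => /andP[_ /andP[]].
Qed.

Lemma path_last_mem p1 w p2 : p = p1 ++ w :: p2 -> v \in w :: p2.
Proof.
move=> def_p; suff -> : v = last w p2 by apply: mem_last.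
by rewrite -p_last -[LHS]/(last u p) def_p last_cat.
Qed.

Lemma loop_start : loop_inv [::] s1.
Proof.
have new x : x \in visited s1 -> x \notin visited s -> x \in p.
  by rewrite -/V1 mem_V1 => /orP[->|].
split=> //; first exact: scan_inv.
- by move=> x y xs /negP[].
- move=> x xs1 xs; have xp := new x xs1 xs.
  case/path.splitPr: {-1}p / xp (erefl p) => p1 p2 def_p.
  exact: path_scan_anc def_p (path_last_mem def_p).
- move=> x y xs1 xs ys1 ys _; have yp := new y ys1 ys.
  case/path.splitPr: {-1}p / (new x xs1 xs) (erefl p) => p1 p2 def_p.
  move: yp; rewrite def_p mem_cat => /orP[yp1|yp2]; last first.
    by rewrite (path_scan_anc def_p yp2) orbT.
  case/path.splitPr: p1 / yp1 def_p => p1 p3; rewrite -catA /= => def_p.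
  by rewrite (path_scan_anc def_p) // inE mem_cat inE eqxx !orbT.
Qed.

Lemma call_grows x w t :
  inv None t -> x \notin visited t -> grows t (set_parS x w t).
Proof.
move=> ti xt; split=> //= y a ya; case: eqP => // yx.
by move: ya; rewrite yx (inv_fresh ti).
Qed.

Lemma call_inv x w t :
  inv None t -> EF w x -> inv (Some x) (set_parS x w t).
Proof.
case=> tW tpar tsound tnew tparS tfresh wx; split=> //= y.
  move=> a; case: eqP => [-> [<-]|_]; [by rewrite EF_sym | exact: tparS].
move=> yt yx; have [e|_] := eqVneq y x; last exact: tfresh.
by rewrite e eqxx in yx.
Qed.

(** The part visited by the call hangs below [w] in [T*]. Only the edges between this part and the
    vertices visited before need a new argument. *)
Lemma loop_call p1 w p2 x t t' :
  p = p1 ++ w :: p2 -> loop_inv p1 t -> EF w x -> x \notin visited t ->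
  inv None t' -> grows (set_parS x w t) t' ->
  explored x (set_parS x w t) t' -> loop_inv p1 t'.
Proof.
move=> def_p [ti s1t tv tclosed tanc tdfs tadjl tdone] wx xt t'i tt'.
case=> /= xt' parSx t'closed t'anc t'dfs; have {}tt' := grows_trans (call_grows w ti xt) tt'.
have tt'v y : y \in visited t -> y \in visited t'.
  exact: (subsetP (grows_visited tt')).
have s1t' := grows_trans s1t tt'.
have wp : w \in p by rewrite def_p mem_cat mem_head orbT.
have s1v y : y \in visited s1 -> y \in visited t.
  exact: (subsetP (grows_visited s1t)).
have sv y : y \in visited s -> y \in visited t.
  by move=> ys; apply: s1v; rewrite -/V1 mem_V1 ys.
have pt y : y \in p -> y \in visited t.
  by move=> yp; apply: s1v; rewrite -/V1 mem_V1 yp orbT.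
have wx' : anc (parS t') w x by apply: anc_par; rewrite parSx /= ?eqxx.
(* An edge from an earlier vertex [y] to a new vertex [z] has [y] on the part
   of the path that is not yet dealt with. *)
have cross y z : y \in visited t -> y \notin visited s -> z \in visited t' ->
    z \notin visited t -> EF y z -> anc (parS t') y z.
  move=> yt ys zt' zt yz.
  (* Outside [V1], [y] was visited by an earlier call from this path, and [tclosed] would make [z]
     visited already. *)
  have yV1 : y \in V1.
    by apply: contraNT zt => yV1; apply: (tclosed y).
  move: yV1; rewrite mem_V1 (negPf ys) def_p mem_cat /= => /orP[yp1|yp2].
    by rewrite (tdone y) in zt.
  apply: anc_trans (anc_mono (grows_parS s1t') (path_scan_anc def_p yp2)) _.
  exact: anc_trans wx' (t'anc _ zt' zt).
split=> //.
- move=> y yvs; have yt : y \in visited t.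
    by case/predU1P: yvs => [->|/sv//]; apply: pt; rewrite -p_last mem_last.
  rewrite -tv // parSx /= ?yt ?orbT //; case: eqP => // yx.
  by rewrite -yx yt in xt.
- move=> y z yt' yV1 yz; have [yt|yt] := boolP (y \in visited t).
    by apply: tt'v; apply: (tclosed y).
  exact: t'closed yt yz.
- move=> y yt' ys; have [yt|yt] := boolP (y \in visited t).
    exact: (anc_mono (grows_parS tt') (tanc _ yt ys)).
  apply: anc_trans (t'anc _ yt' yt); apply: anc_trans wx'.
  exact: (anc_mono (grows_parS tt') (tanc _ (pt _ wp) (p_fresh wp))).
- move=> y z yt' ys zt' zs yz.
  have [yt|yt] := boolP (y \in visited t); have [zt|zt] := boolP (z \in visited t).
  + by have /orP[] := tdfs _ _ yt ys zt zs yz;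
      move/(anc_mono (grows_parS tt')) => ->; rewrite ?orbT.
  + by rewrite cross.
  + by rewrite (cross z y) ?orbT // EF_sym.
  + exact: t'dfs.
- by move=> a b ap ab; apply: tt'v; apply: tadjl ap ab.
- by move=> a b ap ab; apply: tt'v; apply: tdone ap ab.
Qed.

(* An unvisited neighbor [x] of [w] in the old graph would lie in a hanging
   subtree [T(c)]; the query on [T(c)] returns an edge [(y, z)] with [y] among
   the vertices dealt with, so [z] and thus all of [T(c)] have been visited. *)
Lemma loop_next p1 w p2 t :
  p = p1 ++ w :: p2 -> loop_inv p1 t ->
  (forall x, x \in adjl s1 w -> x \in visited t) -> loop_inv (rcons p1 w) t.
Proof.
move=> def_p [ti s1t tv tclosed tanc tdfs tadjl tdone] wt.
have adj_visited a x : a \in rcons p1 w -> x \in adjl s1 a -> x \in visited t.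
  by rewrite mem_rcons inE => /predU1P[->|]; [apply: wt | apply: tadjl].
split=> // a x; rewrite mem_rcons inE => /predU1P[->|]; last exact: tdone.
have wp : w \in p by rewrite def_p mem_cat mem_head orbT.
have s1v y : y \in V1 -> y \in visited t.
  exact: (subsetP (grows_visited s1t)).
have pt y : y \in p -> y \in visited t.
  by move=> yp; apply: s1v; rewrite mem_V1 yp orbT.
(* An inserted edge put [x] in [L(w)] at the outset; an old edge remains. *)
case/orP=> [wx|/(inv_new_edge scan_inv)/wt//].
apply: contraT => xt; have xV1 : x \notin V1 by apply: contra xt; apply: s1v.
have V1_up y b : anc par b y -> y \in V1 -> b \in V1.
  move=> bys yV1.
  exact: (anc_ind_up (P := fun a => a \in V1) yV1 (inv_par scan_inv) bys).
(* Since [V1] is closed under parents, the unvisited [x] cannot lie above [w]. *)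
have wx' : anc par w x.
  have /orP[//|xw] := E_anc wx; case/negP: xV1.
  by apply: V1_up xw _; rewrite mem_V1 wp orbT.
have [|c [b [cV1 bV1 cb cx wb]]] := anc_enter wx' _ xV1.
  by rewrite mem_V1 wp orbT.
have bp : b \in p.
  move: bV1; rewrite mem_V1 => /orP[bs|//].
  have := p_fresh wp.
  by rewrite (anc_ind_up (P := fun a => a \in visited s) bs (inv_par s_inv) wb).
have := Q_path (par_vertex cb); case e: (Q c u v) => [[y z]|]; last first.
  by move=> /(_ w x wp cx); rewrite wx.
case=> yp cz _ /(_ w x wp cx wx) yw.
have zadj : z \in adjl s1 y.
  have [_ _ _ compl _] := scan_spec par Q u v (mark p s) p_uniq.
  rewrite s1_def; apply: compl bp cb _ e.
  by apply: contra cV1; rewrite mem_V1 => ->; rewrite orbT.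
(* Being the highest possible answer, [y] is an ancestor of [w], so it lies on the part of the path
   from [u] down to [w]. *)
have yp1 : y \in rcons p1 w.
  have : (y \in rcons p1 w) || (y \in visited s).
    case: p1 def_p {tadjl tdone adj_visited} => [|a1 p1] [eu eq].
      rewrite -eu; apply: (@chain_anc _ par (visited s) u [::] y u) => //.
        exact: inv_par s_inv.
        exact: mem_head.
      by rewrite eu.
    rewrite rcons_cons -eu.
    apply: (@chain_anc _ par (visited s) u (rcons p1 w) y w) => //.
    - by have := p_path; rewrite eq -cat_rcons cat_path => /andP[].
    - exact: inv_par s_inv.
    - by rewrite inE mem_rcons mem_head orbT.
  by rewrite (negPf (p_fresh yp)) orbF.
have ct : c \in visited t.
  exact: (anc_ind_up (P := fun a => a \in visited t)
           (adj_visited _ _ yp1 zadj) (inv_par ti) cz).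
(* [T(c)] avoids [V1], so [tclosed] applies at each of its visited vertices and carries the visit
   along tree edges from [c] down to [x]. *)
case/negP: xt; move: x cx {wx wx' xV1}.
apply: anc_ind_down => // x d xd cd dt; apply: (tclosed d) => //.
  by apply: contra cV1; apply: V1_up.
by rewrite EF_sym /EF (par_edge xd).
Qed.

Lemma loop_end t : loop_inv p t -> [/\ inv None t, grows s t & explored v s t].
Proof.
case=> ti s1t tv tclosed tanc tdfs _ tdone; split=> //.
  exact: grows_trans scan_grows s1t.
split=> //.
- apply: (subsetP (grows_visited s1t)).
  by rewrite -/V1 mem_V1 -p_last mem_last orbT.
- by move=> x xv; rewrite tv // scan_parS.
move=> x y xt xs xy; have [xV1|xV1] := boolP (x \in V1); last exact: tclosed xV1 xy.
by apply: (tdone x) => //; move: xV1; rewrite mem_V1 (negPf xs).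
Qed.

End Call.

(** * Induction over the recursive calls *)

Lemma for_each_step (A S : Type) (f : A -> S -> option S) a l b b' :
  f a b = Some b' -> for_each f (a :: l) b = for_each f l b'.
Proof. by rewrite /for_each /= => ->. Qed.

(** The number of unvisited vertices drops before each recursive call, as [v] is marked first. It
    also bounds the fuel, both for the recursion and for the while loop, and the final state [t] is
    the same for every sufficient fuel. *)
Lemma dfs_spec m v s :
  #|~: visited s| < m -> v \in W -> v \notin visited s -> inv (Some v) s ->
  exists t, [/\ inv None t, grows s t, explored v s t
    & forall n, #|~: visited s| < n -> Defs.dfs par Q ord n v s = Some t].
Proof.
elim: m v s => [|m IHm] v s; first by rewrite ltn0.
rewrite ltnS => sm vW vs si.
have [q0 [q0_path q0_last q0_uniq]] : exists q0,
    [/\ path (fun b a => par b == Some a) v q0, last v q0 = r & uniq (v :: q0)].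
  have /connectP[q0 q0p q0r] := anc_root vW.
  by case/shortenP: q0p q0r => q1 q1p q1u _ q1r; exists q1.
have [|pb [pb_sub pb_path pb_fresh pb_par pb_climb]] :=
  climb_spec (visited s) [::] q0_path; first by rewrite q0_last.
have pb_uniq : uniq (v :: pb).
  by apply: subseq_uniq q0_uniq; rewrite /= eqxx.
have [u [q def_p]] : exists u q, catrev pb [:: v] = u :: q.
  rewrite -[catrev _ _]/(catrev (v :: pb) [::]) -/(rev _) lastI rev_rcons.
  by eexists; eexists.
have rev_p : u :: q = rev (v :: pb) by rewrite -def_p.
have p_last : last u q = v.
  by rewrite -[LHS]/(last u (u :: q)) rev_p rev_cons last_rcons.
have p_head : last v pb = u.
  by rewrite -[LHS]/(last u (v :: pb)) -[v :: pb]revK -rev_p rev_cons last_rcons.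
have p_path : path (fun a b => par b == Some a) u q.
  have : sorted (fun a b => par b == Some a) (u :: q) by rewrite rev_p rev_sorted.
  by [].
have p_mem x : (x \in u :: q) = (x \in v :: pb) by rewrite rev_p mem_rev.
have p_fresh : {in u :: q, forall x, x \notin visited s}.
  by move=> x; rewrite p_mem inE => /predU1P[->|/pb_fresh].
have p_uniq : uniq (u :: q) by rewrite rev_p rev_uniq.
have p_vertex : {in u :: q, forall x, x \in W}.
  move=> x; rewrite p_mem inE => /predU1P[->//|/(path_pred pb_path)[b _ /eqP bx]].
  by apply: (@EF_vertex b); rewrite /EF (par_edge bx).
have u_par a : par u = Some a -> a \in visited s by rewrite -p_head; apply: pb_par.
set s1 := scan par Q u v (u :: q) (mark (u :: q) s).
have s1_def : s1 = scan par Q u v (u :: q) (mark (u :: q) s) by [].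
have V1_def x := mem_V1 p_uniq s1_def x.
(* The path consists of distinct unvisited vertices, [v] included, so the while loop has enough fuel
   left. *)
have s_size : size pb < #|~: visited s|.
  rewrite -[(size pb).+1]/(size (v :: pb)) -(card_uniqP pb_uniq).
  by apply: subset_leq_card; apply/subsetP => x; rewrite -p_mem in_setC => /p_fresh.
pose LI := loop_inv v s s1.
pose body n w x t := if x \in visited t then Some t
                     else Defs.dfs par Q ord n x (set_parS x w t).
(* The loop over [L(w)]. Fuel [n] suffices for its calls because they start with strictly fewer
   unvisited vertices than [s] has. *)
have inner p1 w p2 l t : u :: q = p1 ++ w :: p2 -> LI p1 t ->
    {in l, forall x, EF w x} ->
  exists t', [/\ LI p1 t', grows t t', {in l, forall x, x \in visited t'}
    & forall n, #|~: visited s| <= n -> for_each (body n w) l t = Some t'].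
  move=> def_p'; elim: l t => [|x l IHl] t tLI wl.
    by exists t; split=> //; apply: grows_refl.
  have wl' : {in l, forall y, EF w y}.
    by move=> y yl; apply: wl; rewrite inE yl orbT.
  have [xt|xt] := boolP (x \in visited t).
    have [t' [t'LI tt' lt' ft']] := IHl t tLI wl'.
    exists t'; split=> //.
      move=> y; rewrite inE => /predU1P[->|/lt'//].
      exact: (subsetP (grows_visited tt')).
    by move=> n sn; rewrite (@for_each_step _ _ _ _ _ _ t) ?ft' // /body xt.
  have wx : EF w x by apply: wl; rewrite mem_head.
  have [ti s1t _ _ _ _ _ _] := tLI.
  have lt_t : #|~: visited t| < #|~: visited s|.
    apply: proper_card; rewrite properE; apply/andP; split.
      rewrite setCS; apply/subsetP => y ys.
      by apply: (subsetP (grows_visited s1t)); rewrite V1_def ys.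
    apply/subsetPn; exists v; rewrite !inE // negbK.
    apply: (subsetP (grows_visited s1t)).
    by rewrite V1_def -p_last mem_last orbT.
  have xW : x \in W by apply: EF_vertex wx.
  have [t1 [t1i tt1 t1e ft1]] :=
    IHm x (set_parS x w t) (leq_trans lt_t sm) xW xt (call_inv ti wx).
  have t1LI : LI p1 t1 by apply: loop_call def_p' tLI wx xt t1i tt1 t1e.
  have [t' [t'LI t1t' lt' ft']] := IHl t1 t1LI wl'.
  exists t'; split=> //.
  - apply: grows_trans t1t'; apply: grows_trans tt1; exact: call_grows.
  - move=> y; rewrite inE => /predU1P[->|/lt'//].
    by apply: (subsetP (grows_visited t1t')); case: t1e.
  - move=> n sn; rewrite (@for_each_step _ _ _ _ _ _ t1) ?ft' // /body (negPf xt).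
    by apply: ft1; apply: leq_trans sn.
have outer p2 p1 t : u :: q = p1 ++ p2 -> LI p1 t ->
  exists2 t', LI (u :: q) t' & forall n, #|~: visited s| <= n ->
    for_each (fun w t => for_each (body n w) (ord w (adjl t w)) t) p2 t = Some t'.
  elim: p2 p1 t => [|w p2 IHp] p1 t def_p' tLI.
    by exists t => //; rewrite def_p' cats0.
  have [ti s1t _ _ _ _ _ _] := tLI.
  have mem_ord x : (x \in ord w (adjl t w)) = (x \in adjl t w).
    by rewrite (perm_mem (ord_spec _ _)) mem_enum.
  have [|t1 [t1LI tt1 lt1 ft1]] := inner p1 w p2 (ord w (adjl t w)) t def_p' tLI.
    by move=> x; rewrite mem_ord => /(inv_sound ti).
  (* Earlier calls may have enlarged [L(w)]; the loop over its current value covers in particular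
     its value in [s1], as [loop_next] requires. *)
  have [||t' t'LI ft'] := IHp (rcons p1 w) t1; first by rewrite cat_rcons.
    apply: loop_next def_p' t1LI _ => // x xw; apply: lt1; rewrite mem_ord.
    exact: (subsetP (grows_adjl s1t w)).
  by exists t' => // n sn; rewrite (@for_each_step _ _ _ _ _ _ t1) ?ft' ?ft1.
have [t tLI ft] := outer (u :: q) [::] s1 erefl
  (loop_start si p_path p_last p_vertex p_fresh p_uniq u_par s1_def).
have [ti st te] := loop_end si p_last p_fresh p_uniq s1_def tLI.
exists t; split=> // -[//|n] sn /=.
by rewrite pb_climb ?def_p /=; [apply: ft | apply: leq_trans s_size _].
Qed.

End Correctness.

(** * From the call at the root to the DFS tree of the updated graph *)

Theorem theorem6 (V : finType) (G : graph V) (r : V) (par : V -> option V)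
    (U : {set V + V * V})
    (Q : V -> V -> V -> option (V * V)) (ord : V -> {set V} -> seq V) :
  undirected G -> super_root G r -> dfs_tree G r par ->
  valid_insertions G U ->
  query_spec (insert_vertices G r U) (extend_tree r U par) Q ->
  order_spec ord ->
  exists parT : V -> option V,
    batch_insert_outputs r Q ord par U parT /\ dfs_tree (insert G r U) r parT.
Proof.
case=> G_sym G_vertex [rG r_adj] [[_ rN par_adj par_out par_root] G_dfs].
case=> new_out new_edges Q_spec ord_spec.
set par' := extend_tree r U par in Q_spec *.
set W := vset G :|: new_vertices U.
set E := adj (insert_vertices G r U).
set F := new_edge U.
have r_new : r \notin new_vertices U by apply: contraL rG; apply: new_out.
have rW : r \in W by rewrite inE rG.
have E_sym : symmetric E.
  by move=> x y; rewrite /E /= G_sym [X in _ || X]orbC.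
have F_sym : symmetric F by move=> x y; rewrite /F /new_edge orbC.
have EF_vertex x y : E x y || F x y -> y \in W.
  case/orP=> [/or3P[/G_vertex[_ yG]|/andP[_ yU]|/andP[/eqP-> _]]|] //.
  - by rewrite inE yG.
  - by rewrite inE yU orbT.
  - by case/orP=> /new_edges[].
have par_edge x a : par x = Some a -> adj G x a.
  move=> xa; have [xG|/par_out] := boolP (x \in vset G); last by rewrite xa.
  have [xr|xr] := eqVneq x r; first by rewrite xr rN in xa.
  by have [b] := par_adj _ xG xr; rewrite xa => -[->].
have par_sub x a : par x = Some a -> par' x = Some a.
  move=> xa; rewrite /par' /extend_tree ifN //.
  by apply: contraL (G_vertex _ _ (par_edge _ _ xa)).1; apply: new_out.
have par'_root : par' r = None by rewrite /par' /extend_tree ifN.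
have par'_edge x a : par' x = Some a -> E x a.
  rewrite /par' /extend_tree; case: ifP => [xU [<-]|_ /par_edge xa].
    by rewrite /E /= xU eqxx !orbT.
  by rewrite /E /= xa.
have new_anc x : x \in new_vertices U -> anc par' r x.
  by move=> xU; apply: anc_par; rewrite /par' /extend_tree xU.
have anc_root x : x \in W -> anc par' r x.
  rewrite inE => /orP[/par_root|/new_anc//].
  exact: anc_mono.
have E_anc x y : E x y -> anc par' x y || anc par' y x.
  case/or3P=> [xy|/andP[/eqP-> /new_anc->]|/andP[/eqP-> /new_anc->]] //; last first.
    by rewrite orbT.
  (* The definition of [dfs_tree] constrains only non-tree edges; a tree edge joins a vertex to its
     parent. *)
  have [xy'|xy'] := eqVneq (par x) (Some y).
    by rewrite orbC (anc_par (par_sub _ _ xy')).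
  have [yx'|yx'] := eqVneq (par y) (Some x).
    by rewrite (anc_par (par_sub _ _ yx')).
  by have /orP[] := G_dfs x y xy xy' yx'; move/(anc_mono par_sub)->; rewrite ?orbT.
have s0_inv : inv W E F par' (Some r) (initial_state U).
  split=> //=; first exact: sub0set.
  - by move=> x a _; rewrite inE.
  - by move=> x y; rewrite inE => xy; apply/orP; right.
  - by move=> x y xy; rewrite inE.
have [|t [ti _ [rt tr tclosed tanc tdfs] run]] := dfs_spec E_sym F_sym EF_vertex
  par'_root par'_edge anc_root E_anc Q_spec ord_spec (ltnSn _) rW _ s0_inv.
  by rewrite inE.
have rW_edge x : x \in W -> x != r -> E r x.
  rewrite inE => /orP[xG xr|xU _]; rewrite /E /=; first by rewrite r_adj.
  by rewrite eqxx xU orbT.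
(* The super root is adjacent to every other vertex, and no edge leaves the explored part, so a
   single call reaches all of [W]. *)
have Wt x : x \in W -> x \in visited t.
  move=> xW; have [->//|xr] := eqVneq x r.
  by apply: (tclosed r) => //; rewrite ?inE // rW_edge.
exists (parS t); split.
  exists #|~: visited (initial_state U)|.+1 => n /run run_n.
  by rewrite /batch_insert run_n.
split.
  split=> //.
  - by rewrite tr ?eqxx.
  - move=> x xW xr; case xa: (parS t x) => [a|].
      by exists a => //; apply: inv_parS ti _ _ xa.
    (* A descendant of [r] in [T*] other than [r] itself must have a pointer. *)
    have /connectP[[|b s] /=] := tanc x (Wt x xW) (negbT (in_set0 x)).
      by move=> _ rx; rewrite rx eqxx in xr.
    by rewrite xa.
  - move=> x xW; apply: (inv_fresh ti) => //.
    by apply: contra xW => /(subsetP (inv_vertex ti)).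
  - by move=> x xW; apply: tanc; [apply: Wt | rewrite inE].
move=> x y xy _ _; apply: tdfs => //; try by rewrite inE.
  by apply: Wt; apply: (EF_vertex y); rewrite E_sym F_sym.
by apply: Wt; apply: EF_vertex xy.
Qed.
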